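(* The smallest elated number of height $14$ is \[\varepsilon_{14}=8579\times 10^{n_{14}}-1,\] where \[n_{14}=\frac{(837\times 10^{13888888}-112)/8-8^2-138}{9^2}.\] Further, $\varepsilon_{14}$ is the only basic elated number of height $14$ less than $8\times 10^{n_{14}+4}$.
   Context: All digits are base $10$. For $a\in\mathbb{Z}^+$ with decimal expansion $a=\sum_{i=0}^n a_i10^i$, $0\le a_i\le 9$, leading digit $a_n\ne 0$, let $E_2(a)=a_n\sum_{i=0}^n a_i^2$. A positive integer $a$ is elated if $E_2^m(a)=1$ for some $m\ge 0$ (iteration), and its height is the smallest such $m$. $\varepsilon_k$ denotes the smallest elated number of height $k$. A number is basic if it is greater than $10$ and its non-leading decimal digits are nonzero and in nondecreasing order (read from left to right). *)

(* Defs.v *)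
From mathcomp Require Import all_boot zify.

Set Implicit Arguments.
Unset Strict Implicit.
Unset Printing Implicit Defensive.

(* [digit a i] is the coefficient of 10 ^ i in the decimal expansion of [a]. *)
Definition digit (a i : nat) : nat := a %/ 10 ^ i %% 10.

(* For [0 < a], the largest [n] with 10 ^ n <= a. *)
Definition lead_pos (a : nat) : nat := trunc_log 10 a.

Definition E2 (a : nat) : nat :=
  digit a (lead_pos a) * \sum_(i < (lead_pos a).+1) digit a i ^ 2.

Definition elated (a : nat) : Prop :=
  0 < a /\ exists m, iter m E2 a = 1.

Definition has_height (a m : nat) : Prop :=
  iter m E2 a = 1 /\ forall k, iter k E2 a = 1 -> m <= k.

Definition elated_of_height (m a : nat) : Prop :=
  elated a /\ has_height a m.

Definition is_smallest (P : nat -> Prop) (a : nat) : Prop :=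
  P a /\ forall b, P b -> a <= b.

(* Larger indices are further to the left. *)
Definition basic (a : nat) : Prop :=
  [/\ 10 < a,
      forall i, i < lead_pos a -> digit a i != 0 &
      forall i j, i <= j -> j < lead_pos a -> digit a j <= digit a i].

Definition n14 : nat :=
  ((837 * 10 ^ 13888888 - 112) %/ 8 - 8 ^ 2 - 138) %/ 9 ^ 2.

(* No subtraction in [n14] is truncated and both divisions are exact. *)
Lemma n14_exact :
  8 * (9 ^ 2 * n14 + 138 + 8 ^ 2) + 112 = 837 * 10 ^ 13888888.
Proof.
rewrite /n14.
have : 3 <= 13888888 by [].
move: 13888888 => k k3.
rewrite -(subnK k3) expnD; move: (k - 3) => {k3}k.
have [t ->] : exists t, 10 ^ k = t * 3 + 1.
  exists (10 ^ k %/ 3); rewrite {1}(divn_eq (10 ^ k) 3); congr (_ + _).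
  by rewrite -modnXm exp1n.
have -> : 837 * ((t * 3 + 1) * 10 ^ 3) =
    8 * (9 ^ 2 * (3875 * t + 1289) + 138 + 8 ^ 2) + 112 by lia.
by rewrite addnK mulKn // !addnK mulKn.
Qed.

(* Main.v *)
Require Import Defs.
From mathcomp Require Import all_boot.
From mathcomp Require Import zify.
From Stdlib Require DecimalNat.

Set Implicit Arguments.
Unset Strict Implicit.
Unset Printing Implicit Defensive.

(** The value of E2 at a number with leading digit [l] is [l * (l ^ 2 + S)],
    where [S] is the sum of the squares of the other digits.  Measured from the
    all-nines tail, [S = 81 * k - gap], with [k] the number of non-leading
    digits and [gap] the sum of the [81 - x ^ 2].  A small gap leaves few
    possibilities for the digits other than 9, whatever [k] is, so that huge
    numbers can be analysed by finite enumerations ([non9_fillings]).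

    Height is decreased by one by E2.  If [b] is a competitor of height 14, then
    [d = E2 b] has at most 13888891 digits, [c = E2 d] is at most about
    [10 ^ 10], and [E2 c] is a number of height 11 of the form [l * (l ^ 2 + T)]
    with [T <= 729].  Enumerating the latter shows that [c] has leading digit 8
    and gap 51, i.e. three further eights and six nines ([height12_shape]).

    Going back up, the same argument is used twice.  Suppose that [c] (or [d])
    has leading digit 8 and a known gap, and is the image under E2 of a number
    with leading digit [l].  A digit [l <= 7] makes the image too small; [l = 9]
    is excluded because no digits with that gap make the digit sum a multiple of
    9; so [l = 8], and divisibility by 8 together with a size bound determines
    all the digits:
    [c = 8999999888 = 9 * 10 ^ 9 - 112] ([height12_dvd8]) and
    [d = 836 9...9 888 = 837 * 10 ^ 13888888 - 112] ([height13_dvd8]).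
    Dividing by 8 gives the gap of the preimage: 168 for [d] ([height13_shape])
    and 105 for [b] ([height14_shape]).

    A gap of 105 forces the digits 5, 7, 8 and otherwise nines after the leading
    8.  The smallest arrangement is 8578 9...9 ([numeral_sort_nines]) and it is
    also the only one whose tail is nondecreasing ([sorted_non9]).

    The numbers [N] (for 13888888) and [n] (for [n14]) only occur through
    [72 * N + 64 = 10 ^ 9] and [24 * n + 64 = 31 * 10 ^ N], which express
    [E2 d = c] and [E2 b = d] for these [c] and [d] and for [b = 8578 9...9]. *)

(** * Numbers as lists of decimal digits, most significant first *)

Definition digits (s : seq nat) : bool := all (leq^~ 9) s.

Definition numeral (s : seq nat) : nat := foldl (fun v x => v * 10 + x) 0 s.

Lemma numeral_rcons s x : numeral (rcons s x) = numeral s * 10 + x.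
Proof. by rewrite /numeral foldl_rcons. Qed.

Lemma numeral_cat s t : numeral (s ++ t) = numeral s * 10 ^ size t + numeral t.
Proof.
elim/last_ind: t => [|t x IH]; first by rewrite cats0 muln1 addn0.
by rewrite -rcons_cat !numeral_rcons IH size_rcons expnSr; lia.
Qed.

Lemma numeral_cons x s : numeral (x :: s) = x * 10 ^ size s + numeral s.
Proof. by rewrite -cat1s numeral_cat. Qed.

Lemma numeral_lt s : digits s -> numeral s < 10 ^ size s.
Proof.
elim: s => //= x s IH /andP[x9 /IH]; rewrite numeral_cons expnS.
by nia.
Qed.

Lemma exists_numeral a : 0 < a ->
  exists l s, [/\ 0 < l <= 9, digits s & a = numeral (l :: s)].
Proof.
elim/ltn_ind: a => a IH a0.
have [a9|a9] := leqP a 9; first by exists a, [::]; rewrite a0 a9.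
have [||l [s [l9 s9 e]]] := IH (a %/ 10); try lia.
exists l, (rcons s (a %% 10)).
rewrite l9 -rcons_cons numeral_rcons -e; split=> //; last by lia.
by rewrite /digits all_rcons; apply/andP; split; first lia.
Qed.

Lemma lead_pos_numeral l s : 0 < l <= 9 -> digits s ->
  lead_pos (numeral (l :: s)) = size s.
Proof.
move=> l9 /numeral_lt slt; apply: trunc_log_eq => //.
by rewrite numeral_cons expnS; nia.
Qed.

Lemma digit_numeral s i : digits s -> digit (numeral s) i = nth 0 (rev s) i.
Proof.
rewrite /digit; elim/last_ind: s i => [|s x IH] i; first by rewrite nth_nil div0n.
rewrite /digits all_rcons => /andP[x9 s9]; rewrite rev_rcons numeral_rcons.
case: i => [|i] /=; first by rewrite divn1; lia.
by rewrite expnS divnMA (_ : _ %/ 10 = numeral s) ?IH //; lia.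
Qed.

Definition sumsq (s : seq nat) : nat := sumn [seq x ^ 2 | x <- s].

Lemma E2_numeral l s : 0 < l <= 9 -> digits s ->
  E2 (numeral (l :: s)) = l * (l ^ 2 + sumsq s).
Proof.
move=> l9 s9; have ls9 : digits (l :: s) by case/andP: l9 => _ l9; rewrite /= l9.
rewrite /E2 lead_pos_numeral // digit_numeral // rev_cons nth_rcons.
rewrite size_rev ltnn eqxx; congr (_ * _).
rewrite (eq_bigr (fun i : 'I_(size s).+1 => nth 0 (rev (l :: s)) i ^ 2));
  last by move=> i _; rewrite digit_numeral.
rewrite -[(size s).+1]/(size (l :: s)) -size_rev.
rewrite -(big_mkord xpredT (fun i => nth 0 (rev (l :: s)) i ^ 2)).
rewrite -(big_nth 0 xpredT (fun x => x ^ 2)).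
rewrite (perm_big (l :: s)) ?perm_rev //= big_cons; congr (_ + _).
by rewrite /sumsq sumnE big_map.
Qed.

(** * Distance of a digit list from the list of nines *)

(** The loss of each digit against 9 in a sum of squares; by [sumsq_gap] it
    determines the sum of squares once the length is fixed. *)
Definition gap (s : seq nat) : nat := sumn [seq 81 - x ^ 2 | x <- s].

Lemma gap_cat s t : gap (s ++ t) = gap s + gap t.
Proof. by rewrite /gap map_cat sumn_cat. Qed.

Lemma sumsq_gap s : digits s -> sumsq s + gap s = 81 * size s.
Proof.
elim: s => //= x s IH /andP[x9 /IH]; rewrite /sumsq /gap /=.
have : x ^ 2 <= 81 by rewrite (leq_exp2r x 9).
lia.
Qed.

Lemma gap_nines k : gap (nseq k 9) = 0.
Proof. by rewrite /gap map_nseq sumn_nseq. Qed.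

Definition non9 (s : seq nat) : seq nat := [seq x <- s | x != 9].

(** A digit other than 9 has gap at least [81 - 64 = 17], so that [D] itself is
    enough fuel for listing all the ways to write [D] as a sum of gaps. *)
Fixpoint fillings_rec (fuel D : nat) : seq (seq nat) :=
  if D == 0 then [:: [::]] else
  if fuel is f.+1 then
    flatten [seq [seq x :: t | t <- fillings_rec f (D - (81 - x ^ 2))]
            | x <- iota 0 9 & 81 - x ^ 2 <= D]
  else [::].

Lemma fillings_rec_gt0 f D : 0 < D -> fillings_rec f.+1 D =
  flatten [seq [seq x :: t | t <- fillings_rec f (D - (81 - x ^ 2))]
          | x <- iota 0 9 & 81 - x ^ 2 <= D].
Proof. by case: D. Qed.

Definition fillings (D : nat) : seq (seq nat) := fillings_rec D D.

Lemma lt9_gap_gt0 x : x < 9 -> 0 < 81 - x ^ 2.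
Proof. by move=> x9; rewrite subn_gt0 (ltn_exp2r x 9). Qed.

(** Nines do not contribute to the gap, so the list of the remaining digits is
    one of finitely many, independently of the length of [s]. *)
Lemma non9_fillings s : digits s -> non9 s \in fillings (gap s).
Proof.
rewrite /fillings => s9; have := leqnn (gap s).
move: {2 3}(gap s) => f; elim: s f s9 => [|x s IH] f /=; first by case: f.
case/andP; rewrite /gap /= -/(gap s) leq_eqVlt => /orP[/eqP-> s9|x9 s9].
  by rewrite eqxx /=; apply: IH.
have g0 := lt9_gap_gt0 x9; rewrite (ltn_eqF x9) /=.
case: f => [|f] h; first by lia.
rewrite fillings_rec_gt0 ?addn_gt0 ?g0 //; apply/flatten_mapP; exists x.
  by rewrite mem_filter mem_iota leq_addr.
by rewrite addKn map_f // IH //; lia.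
Qed.

Lemma gap_eq0_nines s : digits s -> gap s = 0 -> s = nseq (size s) 9.
Proof.
elim: s => //= x s IH /andP[x9 s9]; rewrite /gap /= -/(gap s).
move/eqP; rewrite addn_eq0 => /andP[/eqP gx0 /eqP gs0]; rewrite -IH //.
congr (_ :: _); apply/eqP; rewrite eqn_leq x9 leqNgt; apply/negP.
by move=> /lt9_gap_gt0; rewrite gx0.
Qed.

(** * Divisibility by 9 and by 8, and blocks of nines *)

Definition complement_sum (s : seq nat) : nat := sumn [seq 9 - x | x <- s].

Lemma complement_non9 s : complement_sum (non9 s) = complement_sum s.
Proof.
elim: s => //= x s; rewrite /complement_sum /=.
by case: eqP => [->|_] /= ->.
Qed.

Lemma dvd9_numeral s : digits s -> 9 %| numeral s + complement_sum s.
Proof.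
elim: s => //= x s IH /andP[x9 /IH]; rewrite /complement_sum /= numeral_cons.
have -> : 10 ^ size s = (10 ^ size s %/ 9) * 9 + 1.
  by rewrite {1}(divn_eq (10 ^ size s) 9) -modnXm exp1n.
rewrite mulnDr mulnA muln1; move: (x * _) (numeral s) (sumn _) => q a b; lia.
Qed.

(** The residue modulo 9 only depends on the digit sum, hence on the digits other
    than 9 and not on their positions: a finite check on the gap suffices. *)
Lemma not_dvd9_numeral s :
  all (fun t => ~~ (9 %| (complement_sum t).+1)) (fillings (gap s)) ->
  digits s -> ~~ (9 %| numeral (8 :: s)).
Proof.
move=> /allP chk s9; have /chk := non9_fillings s9.
rewrite complement_non9; apply: contra => h.
have := @dvd9_numeral (8 :: s) s9; rewrite (dvdn_addr _ h).
by rewrite /complement_sum /=; congr (_ %| _).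
Qed.

Fixpoint words (k : nat) : seq (seq nat) :=
  if k is k'.+1 then [seq x :: w | x <- iota 0 10, w <- words k'] else [:: [::]].

Lemma mem_words s : digits s -> s \in words (size s).
Proof.
elim: s => // x s IH /andP[x9 /IH s9].
by apply: (allpairs_f cons); rewrite ?mem_iota.
Qed.

Definition endings8 : seq (seq nat) := [seq w <- words 3 | 8 %| numeral w].

(** As 8 divides 1000, divisibility by 8 is a condition on three digits. *)
Lemma mem_endings8 s w : digits w -> size w = 3 -> 8 %| numeral (s ++ w) ->
  w \in endings8.
Proof.
move=> w9 w3; rewrite numeral_cat w3 dvdn_addr; last by apply: dvdn_mull.
by rewrite mem_filter => ->; rewrite -w3 mem_words.
Qed.

(** For a list [x] of digits in known positions: knowing that the whole number has
    the gap of [v], either the remaining positions have no digits that fit, or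
    [x] is [v] itself. *)
Definition pinned (v x : seq nat) : bool :=
  [|| gap v < gap x, nilp (fillings (gap v - gap x)) | x == v].

(** When [x] is [v] nothing of the gap is left, so the middle part is all nines. *)
Lemma pinnedP v u t w : pinned v (u ++ w) -> digits t ->
  gap (u ++ t ++ w) = gap v -> u ++ w = v /\ t = nseq (size t) 9.
Proof.
move=> pin t9 eq_gap; have {}eq_gap : gap (u ++ w) + gap t = gap v.
  by rewrite -eq_gap !gap_cat; lia.
move: pin; rewrite /pinned -eq_gap ltnNge leq_addr addKn /=.
case/orP => [/nilP none|/eqP uwv]; first by have := non9_fillings t9; rewrite none.
by split=> //; apply: gap_eq0_nines => //; move: eq_gap; rewrite uwv; lia.
Qed.

Lemma numeral_nines u k : (numeral (u ++ nseq k 9)).+1 = (numeral u).+1 * 10 ^ k.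
Proof.
elim: k => [|k IH]; first by rewrite cats0 muln1.
rewrite -[k.+1]addn1 nseqD catA cats1 numeral_rcons addn1 expnSr mulnA -IH; lia.
Qed.

Lemma numeral_nines888 u k :
  numeral (u ++ nseq k 9 ++ [:: 8; 8; 8]) + 112 = (numeral u).+1 * 10 ^ (k + 3).
Proof.
rewrite catA numeral_cat expnD mulnA -numeral_nines /=.
rewrite (_ : numeral [:: 8; 8; 8] = 888) // (_ : 10 ^ 3 = 1000) //.
lia.
Qed.

(** * Heights under E2 *)

Lemma E2_1 : E2 1 = 1.
Proof. exact: (@E2_numeral 1 [::]). Qed.

Lemma iter_E2_eq1_leq k m a : k <= m -> iter k E2 a = 1 -> iter m E2 a = 1.
Proof.
move=> /subnK <- a1; rewrite iterD a1; elim: (m - k) => //= j ->.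
exact: E2_1.
Qed.

(** Since 1 is fixed by E2, the iterates that equal 1 form a final segment, and
    minimality needs to be tested at one index only. *)
Lemma has_heightS m a :
  has_height a m.+1 <-> iter m.+1 E2 a = 1 /\ iter m E2 a <> 1.
Proof.
split=> -[a1].
  by move=> minm; split=> // /minm; rewrite ltnn.
move=> am; split=> // k ak; rewrite ltnNge; apply/negP => km.
by apply: am; apply: iter_E2_eq1_leq ak.
Qed.

Lemma has_height_E2 m a : has_height a m.+2 <-> has_height (E2 a) m.+1.
Proof.
by split=> /has_heightS h; apply/has_heightS; move: h; rewrite !iterSr.
Qed.

Lemma has_height_numeral m a : has_height a m.+1 ->
  exists l s, [/\ 0 < l <= 9, digits s & a = numeral (l :: s)].
Proof.
move=> /has_heightS[a1 _]; apply: exists_numeral; rewrite lt0n.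
apply/eqP => a0; move: a1; rewrite a0.
suff -> : iter m.+1 E2 0 = 0 by [].
elim: m.+1 => //= j ->.
by rewrite /E2 /digit div0n.
Qed.

(** E2 on a sum that evaluates by computation. *)
Definition E2_seq (a : nat) : nat :=
  digit a (lead_pos a) * sumn [seq digit a i ^ 2 | i <- iota 0 (lead_pos a).+1].

Lemma E2_seqE : E2 =1 E2_seq.
Proof.
move=> a; rewrite /E2 /E2_seq sumnE big_map.
by rewrite -(big_mkord xpredT (fun i => digit a i ^ 2)).
Qed.

Lemma height11_enumeration : all (fun l => all (fun T =>
    if iter 10 E2_seq (E2_seq (l * (l ^ 2 + T))) == 1
    then (iter 10 E2_seq (l * (l ^ 2 + T)) == 1)
         || ((l, T) \in [:: (8, 678); (7, 718)])
    else true)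
  (iota 0 730)) (iota 1 9).
Proof. by vm_compute. Qed.

(** The bound 729 is the sum of the squares of nine nines.  Both pairs do occur:
    [8 * (8 ^ 2 + 678) = 5936] and [7 * (7 ^ 2 + 718) = 5369] have height 11. *)
Lemma height11_factor l T : 0 < l <= 9 -> T <= 729 ->
  has_height (l * (l ^ 2 + T)) 11 -> (l, T) \in [:: (8, 678); (7, 718)].
Proof.
move=> l9 T729 /has_heightS[].
rewrite iterSr !(eq_iter E2_seqE) E2_seqE => h1 /eqP h0.
move/allP: height11_enumeration => /(_ l); rewrite mem_iota => /(_ l9) /allP /(_ T).
by rewrite mem_iota => /(_ T729); rewrite h1 eqxx (negbTE h0).
Qed.

(** * Numbers of height 12 below 11 * 10 ^ 9 *)

(** With leading digit 7 the sum of squares 718 would leave a gap of 11, which is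
    less than the smallest gap 17 of a digit other than 9.  With leading digit 8
    the sum of squares 678 exceeds [8 * 81], so there are nine more digits. *)
Lemma height12_shape c : c < 11 * 10 ^ 9 -> has_height c 12 ->
  exists s, [/\ digits s, size s = 9, gap s = 51 & c = numeral (8 :: s)].
Proof.
move=> cB hc; have [l [s [l9 s9 ec]]] := has_height_numeral hc.
move: hc => /has_height_E2; rewrite ec E2_numeral // => h11.
have ss := sumsq_gap s9.
have [T729 l1] : sumsq s <= 729 /\ (9 < size s -> l = 1).
  have [le9|gt9] := leqP (size s) 9; first by split=> //; lia.
  (* An eleven-digit number below the bound starts with 10, and the 0 does not
     add to the sum of squares. *)
  have [x [s' es]] : exists x s', s = x :: s'.
    by case: (s) gt9 => // x s' _; exists x, s'.
  move: s9 ss gt9 cB; rewrite {}ec {}es /= => /andP[x9 s'9].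
  have := sumsq_gap s'9; rewrite !numeral_cons /= expnS => ss' _ sg cB.
  have k9 : 10 ^ 9 <= 10 ^ size s' by rewrite leq_exp2l.
  have k10 : size s' <= 9.
    rewrite leqNgt; apply/negP => s10.
    have : 10 ^ 10 <= 10 ^ size s' by rewrite leq_exp2l.
    move: cB; clear -l9; nia.
  have -> : x = 0 by move: cB; clear -l9 k9; nia.
  have -> : l = 1 by move: cB; clear -l9 k9; nia.
  by rewrite /sumsq /= -/(sumsq s'); split=> //; lia.
have := height11_factor l9 T729 h11.
rewrite !inE !xpair_eqE => /orP[]/andP[/eqP el /eqP eT].
  exists s; rewrite el; split=> //; lia.
have g11 : gap s = 11 by lia.
by have := non9_fillings s9; rewrite g11.
Qed.

Lemma height12_ge c : c < 11 * 10 ^ 9 -> has_height c 12 -> 8 * 10 ^ 9 <= c.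
Proof.
by move=> cB /(height12_shape cB)[s [_ s9 _ ->]]; rewrite numeral_cons s9 leq_addr.
Qed.

Lemma height12_not_dvd9 c : c < 11 * 10 ^ 9 -> has_height c 12 -> ~~ (9 %| c).
Proof.
move=> cB /(height12_shape cB)[s [s9 _ g ->]].
by apply: not_dvd9_numeral => //; rewrite g; vm_compute.
Qed.

(** The last three digits are eights or nines; among such endings only 888 is a
    multiple of 8, which uses up all the eights. *)
Lemma height12_dvd8 c : c < 11 * 10 ^ 9 -> has_height c 12 -> 8 %| c ->
  c + 112 = 9 * 10 ^ 9.
Proof.
move=> cB /(height12_shape cB)[s [s9 sz g ->]].
rewrite -(cat_take_drop 6 s) in s9 g *.
have : size (drop 6 s) = 3 by rewrite size_drop sz.
have : size (take 6 s) = 6 by rewrite size_take sz.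
move: (take 6 s) (drop 6 s) s9 g => t w.
rewrite /digits all_cat => /andP[t9 w9] g st sw; rewrite -cat_cons => d8.
have /allP pin : all (pinned [:: 8; 8; 8]) endings8 by vm_compute.
have /pin pw := mem_endings8 w9 sw d8.
have [/= -> ->] := @pinnedP [:: 8; 8; 8] [::] t w pw t9 g.
by rewrite st (numeral_nines888 [:: 8] 6).
Qed.

(** * Numbers of height 13 with at most N + 3 digits *)

(** The image of [d] is [c = 9 * 10 ^ 9 - 112 = 8 * (8 ^ 2 + S)] with
    [S = 81 * N - 6].  With [N] or [N + 1] non-leading digits the gap would be 6
    or 87, and neither is a sum of gaps of digits. *)
Lemma height13_shape N d : 72 * N + 64 = 10 ^ 9 -> d < 10 ^ (N + 3) ->
  has_height d 13 ->
  exists s, [/\ digits s, size s = N + 2, gap s = 168 & d = numeral (8 :: s)].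
Proof.
move=> eN dB hd; have [l [s [l9 s9 ed]]] := has_height_numeral hd.
have sN : size s <= N + 2.
  rewrite -ltnS -(@ltn_exp2l 10) // -addnS; apply: leq_ltn_trans dB.
  by rewrite ed numeral_cons; case/andP: l9 => l0 _; rewrite -addnC; nia.
have ss := sumsq_gap s9.
have := hd => /has_height_E2; rewrite ed E2_numeral // => hc.
have cB : l * (l ^ 2 + sumsq s) < 11 * 10 ^ 9.
  by rewrite -eN; clear hc ed hd; nia.
have := height12_ge cB hc; have := height12_not_dvd9 cB hc.
have := height12_dvd8 cB hc.
have [l7|l8] := leqP l 7.
  by move=> _ _; rewrite -eN; clear hc ed hd cB; nia.
have [-> _|l_ne9] := eqVneq l 9; first by rewrite dvdn_mulr.
have -> : l = 8 by lia.
rewrite dvdn_mulr // => /(_ isT); rewrite -eN => eS _ _.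
exists s; have [sz|[sz|sz]] : size s = N \/ size s = N + 1 \/ size s = N + 2 by lia.
- have g : gap s = 6 by lia.
  by have := non9_fillings s9; rewrite g.
- have g : gap s = 87 by lia.
  by have := non9_fillings s9; rewrite g.
by split=> //; lia.
Qed.

Lemma height13_ge N d : 72 * N + 64 = 10 ^ 9 -> d < 10 ^ (N + 3) ->
  has_height d 13 -> 8 * 10 ^ (N + 2) <= d.
Proof.
move=> eN dB /(height13_shape eN dB)[s [_ sz _ ->]].
by rewrite numeral_cons sz leq_addr.
Qed.

Lemma height13_not_dvd9 N d : 72 * N + 64 = 10 ^ 9 -> d < 10 ^ (N + 3) ->
  has_height d 13 -> ~~ (9 %| d).
Proof.
move=> eN dB /(height13_shape eN dB)[s [s9 _ g ->]].
by apply: not_dvd9_numeral => //; rewrite g; vm_compute.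
Qed.

(** Multiples of 8 below [838 * 10 ^ N] with leading digit 8 and gap 168: a
    computation over the possible second and third digits, which form a number
    below 38, and the possible last three digits leaves only 36 and 888. *)
Lemma height13_dvd8 N d : 72 * N + 64 = 10 ^ 9 -> d < 838 * 10 ^ N ->
  has_height d 13 -> 8 %| d -> d + 112 = 837 * 10 ^ N.
Proof.
move=> eN dB hd.
have dB' : d < 10 ^ (N + 3).
  by apply: leq_trans dB _; rewrite expnD mulnC leq_mul2l; apply/orP; right.
have [k eNk] : exists k, N = k + 3 by exists (N - 3); lia.
have [s [s9 sz g ed]] := height13_shape eN dB' hd.
move: s9 g ed; rewrite -(cat_take_drop 2 s) -(cat_take_drop k (drop 2 s)).
have : size (take 2 s) = 2 by rewrite size_takel // sz; lia.
have : size (take k (drop 2 s)) = k by rewrite size_takel // size_drop sz; lia.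
have : size (drop k (drop 2 s)) = 3 by rewrite !size_drop sz; lia.
move: (take 2 s) (take k _) (drop k _) => u t w sw st su.
rewrite /digits !all_cat => /and3P[u9 t9 w9] g ed; rewrite ed => d8.
have u38 : numeral u < 38.
  move: dB; rewrite ed numeral_cons numeral_cat !size_cat su st sw -eNk.
  by rewrite addnC expnD (_ : 10 ^ 2 = 100) //; nia.
have /allP/(_ u) :
    all (fun u => all (fun w => pinned [:: 3; 6; 8; 8; 8] (u ++ w)) endings8)
    [seq u <- words 2 | numeral u < 38] by vm_compute.
rewrite mem_filter u38 -{1}su mem_words // => /(_ isT)/allP/(_ w).
rewrite -cat_cons catA in d8; rewrite (mem_endings8 w9 sw d8) => /(_ isT) pin.
have [euw ->] := pinnedP pin t9 g.
have [-> ->] : u = [:: 3; 6] /\ w = [:: 8; 8; 8].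
  by move: euw; case: (u) su => [|? [|? []]] //= _ [-> -> ->].
by rewrite st eNk (numeral_nines888 [:: 8; 3; 6]).
Qed.

(** * Numbers of height 14 below 8 * 10 ^ (n + 4) *)

(** The image of [b] is [837 * 10 ^ N - 112 = 8 * (8 ^ 2 + S)] with
    [S = 81 * n + 138].  With [n + 2] non-leading digits the gap would be 24,
    which is not a sum of gaps of digits. *)
Lemma height14_shape N n b : 72 * N + 64 = 10 ^ 9 -> 24 * n + 64 = 31 * 10 ^ N ->
  b < 8 * 10 ^ (n + 4) -> has_height b 14 ->
  exists s, [/\ digits s, size s = n + 3, gap s = 105 & b = numeral (8 :: s)].
Proof.
move=> eN en bB hb; have [l [s [l9 s9 eb]]] := has_height_numeral hb.
have NQ : N < 10 ^ N by apply: ltn_expl.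
have N100 : 107 < N by lia.
(* The bound on [b] leaves room for [n + 5] digits only when [l <= 7]. *)
have sz : size s <= (if 8 <= l then n + 3 else n + 4).
  rewrite leqNgt; apply/negP => lt_s.
  move: bB; rewrite eb numeral_cons ltnNge => /negP[].
  case: ifP lt_s => l8 lt_s.
    have : 10 ^ (n + 4) <= 10 ^ size s by rewrite leq_exp2l // addnS.
    by nia.
  have : 10 ^ (n + 5) <= 10 ^ size s by rewrite leq_exp2l // addnS.
  by rewrite addnS expnS; nia.
have ss := sumsq_gap s9.
have := hb => /has_height_E2; rewrite eb E2_numeral // => hd.
have Q3 : 10 ^ (N + 3) = 1000 * 10 ^ N by rewrite expnD mulnC.
have dB : l * (l ^ 2 + sumsq s) < 10 ^ (N + 3).
  rewrite Q3; clear hd hb eb bB; move: sz; case: ifP => l8; nia.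
have := height13_ge eN dB hd; have := height13_not_dvd9 eN dB hd.
have [l7|l8] := leqP l 7.
  move=> _; rewrite expnD; clear hd hb eb bB dB; move: sz; rewrite ifF; last by lia.
  by nia.
have [-> |l_ne9] := eqVneq l 9; first by rewrite dvdn_mulr.
move=> _ _; have l_eq8 : l = 8 by lia.
rewrite {}l_eq8 /= {l8 l_ne9 l9} in sz hd eb dB *.
have dB8 : 8 * (8 ^ 2 + sumsq s) < 838 * 10 ^ N by lia.
have eS := height13_dvd8 eN dB8 hd (dvdn_mulr _ _).
exists s; have [sz'|sz'] : size s = n + 2 \/ size s = n + 3 by lia.
  have g : gap s = 24 by lia.
  by have := non9_fillings s9; rewrite g.
by split=> //; lia.
Qed.

(** Moving a nine to the right past other digits does not increase the number. *)
Lemma numeral_sort_nines s : digits s ->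
  numeral (non9 s ++ nseq (size s - size (non9 s)) 9) <= numeral s.
Proof.
elim: s => //= x s IH /andP[x9 s9]; have {IH} := IH s9.
have sub : size (non9 s) <= size s by rewrite size_filter count_size.
have t9 : digits (non9 s).
  by rewrite /digits all_filter; apply: sub_all s9 => y /= ->; rewrite implybT.
case: eqP => [->|_] /= IH; last first.
  by rewrite subSS !numeral_cons size_cat size_nseq subnKC // leq_add2l.
move: IH; rewrite subSn // numeral_cons.
rewrite -ltnS numeral_nines -[X in _ -> is_true X]ltnS numeral_nines expnS.
have -> : 10 ^ size s = 10 ^ size (non9 s) * 10 ^ (size s - size (non9 s)).
  by rewrite -expnD subnKC.
have := numeral_lt t9; move: (numeral (non9 s)) (10 ^ size (non9 s)) => v D vD.
move: (10 ^ (_ - _)) (numeral s) => K m le_m.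
have : v.+1 * K <= D * K by rewrite leq_mul2r vD orbT.
lia.
Qed.

(** * The chain from the candidate down to 1 *)

Lemma height12_of c : c + 112 = 9 * 10 ^ 9 -> has_height c 12.
Proof.
rewrite -(numeral_nines888 [:: 8] 6) => /addIn ->; apply/has_height_E2.
rewrite (@E2_numeral 8) //; apply/has_heightS; rewrite !(eq_iter E2_seqE).
by split; [|apply/eqP]; vm_compute.
Qed.

Lemma height13_of N d : 72 * N + 64 = 10 ^ 9 -> d + 112 = 837 * 10 ^ N ->
  has_height d 13.
Proof.
move=> eN; have [k eNk] : exists k, N = k + 3 by exists (N - 3); lia.
rewrite eNk -(numeral_nines888 [:: 8; 3; 6]) => /addIn ->; apply/has_height_E2.
set s := [:: 3; 6] ++ nseq k 9 ++ [:: 8; 8; 8].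
have s9 : digits s by rewrite /digits /s /= all_cat all_nseq orbT.
have sz : size s = k + 5 by rewrite /s !size_cat size_nseq /=; lia.
have g : gap s = 168 by rewrite /s !gap_cat gap_nines.
have := sumsq_gap s9; rewrite -[X in E2 (numeral X)]/(8 :: s) E2_numeral // => ss.
by apply: height12_of; rewrite -eN; lia.
Qed.

Lemma height14_of N n b : 72 * N + 64 = 10 ^ 9 -> 24 * n + 64 = 31 * 10 ^ N ->
  b.+1 = 8579 * 10 ^ n -> has_height b 14.
Proof.
move=> eN en; have -> : 8579 = (numeral [:: 8; 5; 7; 8]).+1 by vm_compute.
rewrite -numeral_nines => -[->]; apply/has_height_E2.
set s := [:: 5; 7; 8] ++ nseq n 9.
have s9 : digits s by rewrite /digits /s /= all_nseq orbT.
have sz : size s = n + 3 by rewrite /s size_cat size_nseq /=; lia.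
have g : gap s = 105 by rewrite /s !gap_cat gap_nines.
have := sumsq_gap s9; rewrite -[X in E2 (numeral X)]/(8 :: s) E2_numeral // => ss.
by apply: (height13_of eN); lia.
Qed.

(** * Basic numbers as sorted digit lists *)

Lemma digit_tail l s i : 0 < l <= 9 -> digits s -> i < size s ->
  digit (numeral (l :: s)) i = nth 0 s (size s - i.+1).
Proof.
case/andP=> _ l9 s9 lt_i; rewrite digit_numeral; last by rewrite /digits /= l9.
by rewrite rev_cons nth_rcons size_rev lt_i nth_rev.
Qed.

Lemma basic_sorted l s : 0 < l <= 9 -> digits s ->
  basic (numeral (l :: s)) -> sorted leq s.
Proof.
move=> l9 s9 [_ _]; rewrite lead_pos_numeral // => mono.
apply/(sortedP 0) => i lt_i.
have := mono (size s - i.+2) (size s - i.+1).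
rewrite !digit_tail //; try lia.
have -> : size s - (size s - i.+1).+1 = i by lia.
have -> : size s - (size s - i.+2).+1 = i.+1 by lia.
by apply; lia.
Qed.

Lemma sorted_basic l s : 0 < l <= 9 -> digits s -> 10 < numeral (l :: s) ->
  all (leq 1) s -> sorted leq s -> basic (numeral (l :: s)).
Proof.
move=> l9 s9 gt10 /(all_nthP 0) pos srt.
split=> //; rewrite lead_pos_numeral //.
  by move=> i lt_i; rewrite digit_tail // -lt0n; apply: pos; lia.
move=> i j le_ij lt_j; rewrite !digit_tail //; last by lia.
by apply: (sorted_leq_nth leq_trans leqnn) => //; rewrite ?inE; lia.
Qed.

Lemma sorted_non9 s : digits s -> sorted leq s ->
  s = non9 s ++ nseq (size s - size (non9 s)) 9.
Proof.
elim: s => //= x s IH /andP[x9 s9] srt.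
have := IH s9 (path_sorted srt).
have sub : size (non9 s) <= size s by rewrite size_filter count_size.
case: eqP => [x_eq9|_] /=; last by rewrite subSS => <-.
have all9 : s = nseq (size s) 9.
  apply/all_pred1P/allP => y ys /=; rewrite eqn_leq (allP s9) //=.
  by have /allP/(_ y ys) := order_path_min leq_trans srt; rewrite x_eq9.
have -> : non9 s = [::] by rewrite all9 /non9 filter_nseq.
by rewrite subn0 => _; rewrite x_eq9 {1}all9.
Qed.

(** * The smallest number of height 14 *)

Lemma smallest_height14 N n : 72 * N + 64 = 10 ^ 9 -> 24 * n + 64 = 31 * 10 ^ N ->
  is_smallest (elated_of_height 14) (8579 * 10 ^ n - 1) /\
  (forall a : nat,
     [/\ basic a, elated_of_height 14 a & a < 8 * 10 ^ (n + 4)] <->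
     a = 8579 * 10 ^ n - 1).
Proof.
move=> eN en.
have eW : 8579 * 10 ^ n - 1 = numeral ([:: 8; 5; 7; 8] ++ nseq n 9).
  have -> : 8579 = (numeral [:: 8; 5; 7; 8]).+1 by vm_compute.
  by rewrite -numeral_nines subn1.
have W9 : digits ([:: 5; 7; 8] ++ nseq n 9) by rewrite /digits /= all_nseq orbT.
have Wlt : 8579 * 10 ^ n - 1 < 8 * 10 ^ (n + 4).
  have -> : 8579 = (numeral [:: 8; 5; 7; 8]).+1 by vm_compute.
  have := expn_gt0 10 n.
  have : (numeral [:: 8; 5; 7; 8]).+1 <= 8 * 10 ^ 4 by vm_compute.
  by rewrite expnD; move: (numeral _) (10 ^ n) (10 ^ 4); clear; nia.
have Wh : elated_of_height 14 (8579 * 10 ^ n - 1).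
  have hW : has_height (8579 * 10 ^ n - 1) 14.
    apply: (height14_of eN en); rewrite subn1 prednK // muln_gt0 expn_gt0 andbT.
    by vm_compute.
  split=> //; split; last by exists 14; case: hW.
  have [l [s [/andP[l0 _] _ ->]]] := has_height_numeral hW.
  by rewrite numeral_cons addn_gt0 muln_gt0 l0 expn_gt0.
split.
  split=> // b [_ hb]; have [bB|] := ltnP b (8 * 10 ^ (n + 4)); last first.
    by apply: leq_trans; apply: ltnW.
  have [s [s9 sz g ->]] := height14_shape eN en bB hb.
  have : all (fun t => (size t == 3) && (578 <= numeral t)) (fillings 105).
    by vm_compute.
  move=> /allP/(_ (non9 s)); rewrite -{1}g.
  move=> /(_ (non9_fillings s9))/andP[/eqP st le_t].
  have := numeral_sort_nines s9; rewrite st sz addnK eW numeral_cons sz /= => le_s.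
  rewrite numeral_cons /= size_nseq leq_add //; first by rewrite addn3.
  apply: leq_trans le_s.
  rewrite -ltnS (numeral_nines [:: 5; 7; 8]) numeral_nines.
  by rewrite leq_mul2r ltnS le_t orbT.
move=> a; split=> [[ba [_ ha] aB]|->].
  have [s [s9 sz g ea]] := height14_shape eN en aB ha.
  have srt : sorted leq s by apply: (@basic_sorted 8); rewrite // -ea.
  have es := sorted_non9 s9 srt.
  have : all (fun t => sorted leq t ==> (t == [:: 5; 7; 8])) (fillings 105).
    by vm_compute.
  move=> /allP/(_ (non9 s)); rewrite -{1}g => /(_ (non9_fillings s9)).
  rewrite sorted_filter ?implyTb => // [/eqP e578|]; last exact: leq_trans.
  by rewrite ea eW es e578 sz addnK.
split=> //; rewrite eW; apply: sorted_basic => //.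
- by rewrite numeral_cons /= size_nseq !expnS; have := expn_gt0 10 n; lia.
- by rewrite /= all_nseq orbT.
by case: (n) => //= m; elim: m.
Qed.

(** Reads a decimal numeral by Horner's rule: the unary form of 13888888 is too
    large to be compared by computation. *)
Lemma of_num_uintE d :
  Nat.of_num_uint (Number.UIntDecimal d) =
  DecimalNat.Unsigned.of_lu (Decimal.rev d).
Proof. exact: DecimalNat.Unsigned.of_uint_alt. Qed.

Theorem theorem21 :
  is_smallest (elated_of_height 14) (8579 * 10 ^ n14 - 1) /\
  (forall a : nat,
     [/\ basic a, elated_of_height 14 a & a < 8 * 10 ^ (n14 + 4)] <->
     a = 8579 * 10 ^ n14 - 1).
Proof.
apply: (@smallest_height14 13888888).
  rewrite of_num_uintE.
  cbv [DecimalNat.Unsigned.of_lu Decimal.rev Decimal.revapp].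
  lia.
move: n14_exact; move: n14 (10 ^ _) => n Q; lia.
Qed.
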